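(* For $f\in\mathcal L_{4,4}^+$ with normalized coefficients $c_\alpha$ ($\alpha\in\Delta_4^4$; e.g. $c_{1030}$ means $c_{(1,0,3,0)}$), let $$R_4(f)=\frac{c_{1030}\,c_{3010}\,c_{0202}}{c_{2020}\,c_{1012}\,c_{1210}},$$ and let $w_4\in\mathbb R^{\Delta_4^4}$ be its exponent vector (entry $+1$ at the three numerator indices, $-1$ at the three denominator indices, $0$ elsewhere). Then for every $f\in\mathcal L_{4,4}^+$, $R_4(f)\le 64$. Moreover, $$w_4\in\operatorname{BR}(\mathcal L_{4,4}^+)\setminus\operatorname{Cone}\bigl(\mathcal G_4(\Delta_4^4)\bigr).$$
   Context: Notation: $\mathbb N=\mathbb Z_{\ge0}$, $[n]=\{1,\dots,n\}$, $e_i$ is the $i$-th standard basis vector of $\mathbb R^n$; for $\alpha\in\mathbb N^n$, $|\alpha|=\alpha_1+\cdots+\alpha_n$, $\alpha!=\alpha_1!\cdots\alpha_n!$, and $\mathbf x^\alpha=x_1^{\alpha_1}\cdots x_n^{\alpha_n}$; $\Delta_n^d=\{\alpha\in\mathbb N^n:|\alpha|=d\}$. For a finite set $S$, $\varepsilon_\alpha$ ($\alpha\in S$) denotes the standard basis of $\mathbb R^S$. $\operatorname{Cone}(E)$ is the set of finite nonnegative linear combinations of elements of $E$. A nonempty set $S\subseteq\Delta_n^d$ is $M$-convex if, whenever $\alpha,\beta\in S$ and $\alpha_i>\beta_i$, there is $j$ with $\alpha_j<\beta_j$ such that $\alpha-e_i+e_j\in S$ and $\beta-e_j+e_i\in S$.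 Lorentzian polynomials: for $d\ge2$, a polynomial $f=\sum_{\alpha\in\Delta_n^d}c_\alpha\,\mathbf x^\alpha/\alpha!$ with all $c_\alpha\ge0$, not identically zero, is Lorentzian if and only if its support $\{\alpha:c_\alpha\ne0\}$ is $M$-convex and for every $\beta\in\Delta_n^{d-2}$ the symmetric matrix $H_\beta(f)=(c_{\beta+e_i+e_j})_{1\le i,j\le n}$ (the Hessian of $\partial^\beta f$) has at most one positive eigenvalue. The numbers $c_\alpha$ are called the normalized coefficients of $f$. For an $M$-convex $S\subseteq\Delta_n^d$, $\mathcal L_S^+$ is the set of Lorentzian polynomials whose normalized coefficients $c_\alpha$ are positive exactly for $\alpha\in S$; $\mathcal L_{n,d}^+:=\mathcal L_{\Delta_n^d}^+$. For $w\in\mathbb R^S$ and $f\in\mathcal L_S^+$ put $R_w(f)=\prod_{\alpha\in S}c_\alpha^{w_\alpha}$, and $\operatorname{BR}(\mathcal L_S^+)=\{w\in\mathbb R^S:\sup_{f\in\mathcal L_S^+}R_w(f)<\infty\}$. Quadratic local generators: for $\beta\in\Delta_n^{d-2}$ let $S_\beta=\{e_i+e_j:i,j\in[n],\ \beta+e_i+e_j\in S\}\subseteq\Delta_n^2$ (which is $M$-convex whenever nonempty; for $S=\Delta_n^d$ it is $\Delta_n^2$). For $v\in\mathbb R^{S_\beta}$ let $\widetilde v^{\,\beta}=\sum_{\gamma\in S_\beta}v_\gamma\varepsilon_{\beta+\gamma}\in\mathbb R^S$. Then $\mathcal G_n(S)=\bigcup_{\beta\in\Delta_n^{d-2},\,S_\beta\ne\varnothing}\{\widetilde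 v^{\,\beta}:v\in\operatorname{BR}(\mathcal L_{S_\beta}^+)\}$. *)

(* Defs.v *)
From HB Require Import structures.
From mathcomp Require Import all_boot all_order all_algebra finmap.
(* mpoly has to be imported before the MathComp-Analysis files: in the other
   order their notations clash. *)
From mathcomp Require Import mpoly.
From mathcomp Require Import boolp classical_sets reals ereal exp.

Set Implicit Arguments.
Unset Strict Implicit.
Unset Printing Implicit Defensive.

Import Order.TTheory GRing.Theory Num.Theory.

Local Open Scope classical_set_scope.
Local Open Scope ring_scope.

(* [R^o] rather than [R] as codomain, so that the vectors form an [lmodType]. *)
Notation "''R[' R ]^ S" := {ffun S -> R^o}
  (at level 8, R at level 2, S at level 2, format "''R[' R ]^ S") : type_scope.

Definition Delta (n d : nat) : {fset 'X_{1..n}} :=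
  [fset a in [seq bmnm b | b : 'X_{1..n < d.+1}] | mdeg a == d]%fset.

Lemma in_Delta (n d : nat) (a : 'X_{1..n}) : (a \in Delta n d) = (mdeg a == d).
Proof.
rewrite !inE /=; apply/andP/idP => [[]//|/eqP da]; split; last exact/eqP.
have lta : (mdeg a < d.+1)%N by rewrite da.
by apply/fintype.imageP; exists (BMultinom lta).
Qed.

(* The subtraction of multinomials is truncated, but the side conditions
   [b i < a i] and [a j < b j] ensure that here it is the actual one. *)
Definition Mconvex (n d : nat) (S : set 'X_{1..n}) : Prop :=
  [/\ S !=set0,
      S `<=` [set` Delta n d]
    & forall a b : 'X_{1..n}, S a -> S b ->
      forall i : 'I_n, (b i < a i)%N ->
      exists j : 'I_n, [/\ (a j < b j)%N,
        S (a - U_(i) + U_(j))%MM & S (b - U_(j) + U_(i))%MM]].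

(* The eigenvalues are counted with multiplicity; the characteristic polynomial
   of a symmetric real matrix always splits. *)
Definition at_most_one_pos_eigenvalue (R : realType) (n : nat) (A : 'M[R]_n) :=
  exists2 s : seq R, char_poly A = \prod_(x <- s) ('X - x%:P)
                   & (count (fun x : R => (0 < x)%R) s <= 1)%N.

Section Lorentzian.
Variables (R : realType) (n : nat).
Implicit Types (f : {mpoly R[n]}) (a b : 'X_{1..n}) (S : {fset 'X_{1..n}}).

(* [f = \sum_a ncoef f a *: 'X_[a] / a!] *)
Definition ncoef f a : R := (\prod_(i < n) (a i)`!)%N%:R * f@_a.

Definition hessian f b : 'M[R]_n :=
  \matrix_(i, j) ncoef f (b + U_(i) + U_(j))%MM.

(* Intended for [2 <= d]; [mdeg b + 2 = d] is [mdeg b = d - 2] without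
   truncation. *)
Definition lorentzian (d : nat) f : Prop :=
  [/\ f != 0, f \is d.-homog,
      forall a, 0 <= ncoef f a,
      Mconvex d [set a | ncoef f a != 0]
    & forall b, (mdeg b + 2)%N = d -> at_most_one_pos_eigenvalue (hessian f b)].

Definition lorentzian_pos (d : nat) S : set {mpoly R[n]} :=
  [set f | lorentzian d f /\ forall a, 0 < ncoef f a <-> a \in S].

Definition coef_ratio S (w : 'R[R]^S) f : R :=
  \prod_(a : S) ncoef f (val a) `^ w a.

Definition BR (d : nat) S : set 'R[R]^S :=
  [set w | (ereal_sup [set (coef_ratio w f)%:E | f in lorentzian_pos d S] < +oo)%E].
Arguments BR d S : clear implicits.

Definition local_support S b : {fset 'X_{1..n}} :=
  [fset (U_(p.1) + U_(p.2))%MM |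
     p in [pred p : 'I_n * 'I_n | (b + (U_(p.1) + U_(p.2)))%MM \in S]]%fset.

Definition local_lift S b (v : 'R[R]^(local_support S b)) : 'R[R]^S :=
  [ffun a : S =>
     \sum_(g : local_support S b) v g * (val a == (b + val g)%MM)%:R].

Definition quadratic_local_generators (d : nat) S : set 'R[R]^S :=
  [set w | exists b : 'X_{1..n},
     [/\ (mdeg b + 2)%N = d, local_support S b != fset0
       & exists2 v : 'R[R]^(local_support S b),
           BR 2 (local_support S b) v & w = local_lift v]].

End Lorentzian.

Arguments BR {R n} d S.
Arguments quadratic_local_generators {R n} d S.

Definition Cone (R : realType) (V : lmodType R) (E : set V) : set V :=
  [set x | exists (k : nat) (l : 'I_k -> R) (g : 'I_k -> V),
     [/\ forall i, 0 <= l i, forall i, E (g i)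
       & x = \sum_(i < k) l i *: g i]].

Definition mon4 (p q r s : nat) : 'X_{1..4} := [multinom [tuple p; q; r; s]].

Definition R4 (R : realType) (f : {mpoly R[4]}) : R :=
  (ncoef f (mon4 1 0 3 0) * ncoef f (mon4 3 0 1 0) * ncoef f (mon4 0 2 0 2)) /
  (ncoef f (mon4 2 0 2 0) * ncoef f (mon4 1 0 1 2) * ncoef f (mon4 1 2 1 0)).

Definition w4 (R : realType) : 'R[R]^(Delta 4 4) :=
  [ffun a : Delta 4 4 =>
     if val a \in [:: mon4 1 0 3 0; mon4 3 0 1 0; mon4 0 2 0 2] then 1
     else if val a \in [:: mon4 2 0 2 0; mon4 1 0 1 2; mon4 1 2 1 0] then -1
     else 0].

(* Main.v *)
Require Import Defs.
From HB Require Import structures.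
From mathcomp Require Import all_boot all_order all_algebra finmap.
From mathcomp Require Import complex.
From mathcomp Require Import mpoly.
From mathcomp Require Import boolp classical_sets reals ereal sequences exp.
From mathcomp Require Import ring lra.

(* Upper bound.  Let F be the symmetric 4-linear form with
   F(e_i, e_j, e_k, e_l) = c_(e_i + e_j + e_k + e_l).  The Hessian condition is
   a reverse Cauchy-Schwarz inequality for the forms F(e_i, e_j, -, -), and
   Bochner's method transfers it to F(y, e_j, -, -) and F(y, y, -, -), where
   y = e_1 + t e_3 and t > 0.  Multiplying local inequalities
   Q(y, y) Q(u, v) <= 2 Q(y, u) Q(y, v) gives the reverse Khovanskii-Teissier
   inequality
     F(2, 2, 4, 4) F(y, y, y, y) <= 16 F(2, 2, y, y) F(4, 4, y, y).
   Here and below an index i among the arguments of F stands for e_i.  The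
   unwanted terms F(1, 1, 2, 2), F(3, 3, 2, 2) on its right-hand side, and those
   with 4 instead of 2, are controlled by
     F(1, 1, 2, 2) F(1, 3, 3, 3) <= 4 F(1, 3, 2, 2) F(1, 1, 3, 3),
     F(1, 1, 2, 2) F(3, 3, 2, 2) <= F(1, 3, 2, 2)^2
   and their analogues, and a suitable t then yields 64.

   Separation.  An integer weight p on the degree 4 simplex pairs positively
   with w_4, whereas each restriction p(b + -) to the degree 2 simplex is a
   linear function plus at most two cut functions.  A linear function plus a
   cut function is the logarithm of the coefficients of a Lorentzian quadratic
   form of rank at most 2, and so is every positive multiple of it; hence it
   pairs nonpositively with the bounded ratios of quadratic forms. *)

Set Implicit Arguments.
Unset Strict Implicit.
Unset Printing Implicit Defensive.

Import Order.TTheory GRing.Theory Num.Theory.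

Local Open Scope classical_set_scope.
Local Open Scope ring_scope.

(** * Symmetric matrices with at most one positive eigenvalue *)

Lemma sesqui_sum_expand (C : numClosedFieldType) (I : finType)
    (d u v : I -> C) (a b : C) :
  \sum_i d i * (a * u i - b * v i) * Num.conj (a * u i - b * v i) =
    a * Num.conj a * (\sum_i d i * u i * Num.conj (u i))
    - a * Num.conj b * (\sum_i d i * u i * Num.conj (v i))
    - b * Num.conj a * (\sum_i d i * v i * Num.conj (u i))
    + b * Num.conj b * (\sum_i d i * v i * Num.conj (v i)).
Proof.
rewrite !mulr_sumr -!sumrB -big_split /=.
by apply: eq_bigr => i _; rewrite rmorphB !rmorphM /=; ring.
Qed.

Lemma sqr_normB_real (C : numClosedFieldType) (x z u v : C) :
  Num.conj x = x -> Num.conj z = z ->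
  `|x * v - z * u| ^+ 2 = x * x * (v * Num.conj v) - x * z * (v * Num.conj u)
    - z * x * (u * Num.conj v) + z * z * (u * Num.conj u).
Proof. by move=> xr zr; rewrite normCK rmorphB !rmorphM /= xr zr; ring. Qed.

Section Spectral.
Local Open Scope sesquilinear_scope.
Context {R : realType}.
Local Notation "A ^C" := (map_mx (real_complex R) A).

Lemma conj_toC (x : R) : Num.conj (x%:C%C) = x%:C%C.
Proof. by apply: conj_Creal; apply/complex_realP; exists x. Qed.

Lemma char_poly_conj (F : fieldType) n (P A : 'M[F]_n) :
  P \in unitmx -> char_poly (invmx P *m A *m P) = char_poly A.
Proof.
move=> Pu; rewrite /char_poly /char_poly_mx.
pose Q := map_mx polyC P; pose Q' := map_mx polyC (invmx P).
have QQ : Q' *m Q = 1%:M by rewrite -map_mxM mulVmx // map_mx1.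
have -> : 'X%:M - map_mx polyC (invmx P *m A *m P) =
   Q' *m ('X%:M - map_mx polyC A) *m Q.
  rewrite !map_mxM mulmxBr mulmxBl; congr (_ - _).
  by rewrite mul_mx_scalar -scalemxAl QQ scalemx1.
rewrite !det_mulmx mulrC mulrA -det_mulmx.
by have := QQ => /mulmx1C ->; rewrite det1 mul1r.
Qed.

(** The complexification is Hermitian, hence unitarily diagonalizable with real eigenvalues. [U]
    stays complex, but the factorization of [char_poly A] descends to [R] because passing to complex
    coefficients is injective on polynomials. *)
Lemma symmetric_spectral n (A : 'M[R]_n) : A^T = A ->
  exists (d : 'I_n -> R) (U : 'M[R[i]%C]_n),
    [/\ U *m U ^t* = 1%:M,
        A^C = U ^t* *m diag_mx (\row_i (d i)%:C%C) *m U
      & char_poly A = \prod_i ('X - (d i)%:P)].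
Proof.
move=> symA.
have Aherm : A^C \is hermsymmx.
  apply/is_hermitianmxP; rewrite expr0 scale1r; apply/matrixP => i j.
  by rewrite !mxE /= conj_toC -[in LHS]symA mxE.
have /hermitian_normalmx/orthomx_spectralP eqA := Aherm.
have /mxOverP dreal := hermitian_spectral_diag_real Aherm.
have Uu := spectral_unitarymx A^C.
set U := spectralmx _ in eqA Uu; set D := spectral_diag _ in eqA dreal.
pose d i : R := complex.Re (D 0 i).
have DE : D = \row_i (d i)%:C%C.
  by apply/rowP => i; rewrite mxE RRe_real.
exists d, U; split; first exact/unitarymxP.
  by rewrite -DE -invmx_unitary.
apply: (map_poly_inj (real_complex R)).
rewrite map_char_poly {1}eqA char_poly_conj ?unitarymx_unit //.
rewrite char_poly_trig ?diag_mx_is_trig // rmorph_prod.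
apply: eq_bigr => i _.
by rewrite rmorphB /= map_polyX map_polyC /= DE !mxE eqxx mulr1n.
Qed.

Definition bform n (A : 'M[R]_n) (x y : 'rV[R]_n) : R := (x *m A *m y^T) 0 0.

(** Reverse Cauchy-Schwarz against a fixed [y]. For symmetric [A] with [bform A y y] positive, it
    says that [A] is negative semidefinite on the orthogonal complement of [y]. *)
Definition hyperbolic_at n (A : 'M[R]_n) (y : 'rV[R]_n) :=
  forall x, bform A y y * bform A x x <= bform A y x ^+ 2.

Lemma bform_spectral n (A : 'M[R]_n) (d : 'I_n -> R) (U : 'M[R[i]%C]_n) x y :
  A^C = U ^t* *m diag_mx (\row_i (d i)%:C%C) *m U ->
  ((bform A x y)%:C)%C = \sum_i (d i)%:C%C * (x^C *m U ^t*) 0 i *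
                               Num.conj ((y^C *m U ^t*) 0 i).
Proof.
move=> eqA.
have -> : ((bform A x y)%:C)%C = (x^C *m A^C *m (y^C)^T) 0 0.
  by rewrite map_trmx -!map_mxM mxE.
rewrite eqA !mulmxA -[_ *m U *m _]mulmxA mxE; apply: eq_bigr => i _.
rewrite mul_mx_diag mxE [(\row_k _) 0 i]mxE [X in X * _ = _]mulrC; congr (_ * _).
rewrite mxE [in RHS]mxE rmorph_sum; apply: eq_bigr => j _.
by rewrite !mxE rmorphM /= conj_toC conjCK mulrC.
Qed.

(** Let [u], [v] be the eigen-coordinates of [y], [x], and [k] the only index with a positive
    eigenvalue. The combination [v k * u - u k * v] has no [k]-th coordinate, so the form [S] there
    is nonpositive. *)
Lemma at_most_one_pos_hyperbolic n (A : 'M[R]_n) y : A^T = A ->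
  at_most_one_pos_eigenvalue A -> 0 < bform A y y -> hyperbolic_at A y.
Proof.
move=> symA [s + sle1] ypos x; rewrite leNgt.
have [d [U [UU eqA ->]]] := symmetric_spectral symA.
rewrite -(big_map d xpredT (fun c => 'X - c%:P)).
move=> /prod_XsubC_eq/permP/(_ (fun x => 0 < x)) cnt; rewrite -cnt in sle1.
apply/negP => lt_zxy.
set X := bform A y y in ypos lt_zxy; set W := bform A x x in lt_zxy.
set Z := bform A y x in lt_zxy.
pose u i := (y^C *m U ^t*) 0 i; pose v i := (x^C *m U ^t*) 0 i.
have XE : (X%:C)%C = \sum_i (d i)%:C%C * u i * Num.conj (u i).
  exact: bform_spectral.
have WE : (W%:C)%C = \sum_i (d i)%:C%C * v i * Num.conj (v i).
  exact: bform_spectral.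
have ZE : (Z%:C)%C = \sum_i (d i)%:C%C * u i * Num.conj (v i).
  exact: bform_spectral.
have ZE' : (Z%:C)%C = \sum_i (d i)%:C%C * v i * Num.conj (u i).
  rewrite -conj_toC ZE rmorph_sum; apply: eq_bigr => i _.
  by rewrite !rmorphM /= conjCK conj_toC mulrAC.
have le0 (P : pred 'I_n) (w : 'I_n -> R[i]%C) :
    (forall i, P i -> d i <= 0) -> 
    \sum_(i | P i) (d i)%:C%C * w i * Num.conj (w i) <= 0.
  move=> dP; apply: sumr_le0 => i Pi; rewrite -mulrA -normCK.
  by rewrite mulr_le0_ge0 ?exprn_ge0 // lecR dP.
have [k dk] : exists k, 0 < d k.
  apply/not_existsP => dN; move: (le0 xpredT u).
  rewrite -XE lecR leNgt ypos => /(_ _)/negP; case => // i _.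
  by rewrite leNgt; apply/negP/dN.
have dk' i : i != k -> d i <= 0.
  move=> ik; rewrite leNgt; apply/negP => di.
  move: sle1; rewrite count_map leqNgt => /negP; apply.
  rewrite -size_filter (_ : 2%N = size [:: i; k]) //; apply: uniq_leq_size.
    by rewrite /= inE ik.
  by move=> j; rewrite !inE mem_filter mem_index_enum andbT => /orP[]/eqP->.
pose S := \sum_i (d i)%:C%C * (v k * u i - u k * v i) *
                   Num.conj (v k * u i - u k * v i).
have SE : S = v k * Num.conj (v k) * X%:C%C - v k * Num.conj (u k) * Z%:C%C
            - u k * Num.conj (v k) * Z%:C%C + u k * Num.conj (u k) * W%:C%C.
  by rewrite /S sesqui_sum_expand -XE -WE -ZE -ZE'.
have Sle0 : S <= 0.
  rewrite /S (bigD1 k) //= [u k * v k]mulrC subrr mulr0 mul0r add0r.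
  exact: le0.
(* Completing the square isolates the excess [X * W - Z ^+ 2], assumed positive. Since [S <= 0],
   this forces [u k = 0], and then [X] itself cannot be positive. *)
have XS : X%:C%C * S = `|X%:C%C * v k - Z%:C%C * u k| ^+ 2
                     + `|u k| ^+ 2 * (X * W - Z ^+ 2)%:C%C.
  rewrite SE (sqr_normB_real _ _ (conj_toC X) (conj_toC Z)) normCK.
  by rewrite expr2 rmorphB !rmorphM /=; ring.
have : `|u k| ^+ 2 * (X * W - Z ^+ 2)%:C%C <= 0.
  apply: le_trans (_ : X%:C%C * S <= 0); last first.
    by rewrite mulr_ge0_le0 // lecR ltW.
  by rewrite XS lerDr exprn_ge0.
rewrite pmulr_lle0 ?ltcR ?subr_gt0 // => uk0.
have {}uk0 : u k = 0.
  by apply/eqP; rewrite -normr_eq0 -sqrf_eq0 eq_le uk0 exprn_ge0.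
have : X%:C%C <= 0.
  by rewrite XE (bigD1 k) //= uk0 mulr0 mul0r add0r; apply: le0.
by rewrite lecR leNgt ypos.
Qed.

(** Two positive eigenvalues would make the form positive definite on a plane. That plane contains a
    nonzero vector killed by [l], where only the nonpositive part given by [B] remains. *)
Lemma at_most_one_pos_rank1B n m (l : 'rV[R]_n) (B : 'M[R]_(m, n)) :
  at_most_one_pos_eigenvalue (l^T *m l - B^T *m B).
Proof.
set A := _ - _.
have symA : A^T = A by rewrite linearB /= !trmx_mul !trmxK.
have [d [U [UU eqA charA]]] := symmetric_spectral symA.
exists [seq d i | i <- index_enum 'I_n]; first by rewrite charA big_map.
rewrite count_map leqNgt; apply/negP => /= cnt.
have [i [j [ij di dj]]] : exists i j, [/\ i != j, 0 < d i & 0 < d j].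
  move: cnt; rewrite -size_filter.
  have : uniq [seq x <- index_enum 'I_n | 0 < d x].
    by rewrite filter_uniq // index_enum_uniq.
  have : all (fun i => 0 < d i) [seq x <- index_enum 'I_n | 0 < d x].
    exact: filter_all.
  case: [seq x <- _ | _] => [//|i [//|j t]] /= /and3P[di dj _] /andP[+ _] _.
  by rewrite inE negb_or => /andP[ij _]; exists i, j.
pose c (a : 'I_n) := (U *m (l^C)^T) a 0.
(* The case split keeps [w] nonzero: the combination would vanish if [c i] and [c j] were both 0. *)
pose w : 'rV[R[i]%C]_n :=
  if (c i == 0) then delta_mx 0 i else c j *: delta_mx 0 i - c i *: delta_mx 0 j.
have wc : (w *m (U *m (l^C)^T)) 0 0 = 0.
  rewrite /w; case: eqP => [ci0|_]; first by rewrite -rowE mxE.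
  by rewrite mulmxBl -!scalemxAl -!rowE /c !mxE mulrC subrr.
pose q := (w *m diag_mx (\row_i (d i)%:C%C) *m w ^t*) 0 0.
have qpos : 0 < q.
  rewrite /q mul_mx_diag mxE.
  under eq_bigr do rewrite !mxE mulrAC -normCK.
  have ge0 k : 0 <= `|w 0 k| ^+ 2 * (d k)%:C%C.
    case: (altP (k =P i)) => [->|ki].
      by rewrite mulr_ge0 ?exprn_ge0 // lecR ltW.
    case: (altP (k =P j)) => [->|kj].
      by rewrite mulr_ge0 ?exprn_ge0 // lecR ltW.
    suff -> : w 0 k = 0 by rewrite normr0 expr0n mul0r.
    by rewrite /w; case: ifP => _;
      rewrite !mxE (negPf ki) ?(negPf kj) ?andbF ?mulr0 ?subrr.
  have [ci0|ciN0] := eqVneq (c i) 0.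
    rewrite (bigD1 i) //= ltr_pwDl ?sumr_ge0 //.
    rewrite pmulr_rgt0 ?ltcR // exprn_gt0 // normr_gt0.
    by rewrite /w ci0 eqxx mxE !eqxx oner_eq0.
  rewrite (bigD1 j) //= ltr_pwDl ?sumr_ge0 //.
  rewrite pmulr_rgt0 ?ltcR // exprn_gt0 // normr_gt0.
  rewrite /w (negPf ciN0) !mxE !eqxx [j == i]eq_sym (negPf ij) /=.
  by rewrite mulr0 mulr1 sub0r oppr_eq0.
have : q <= 0.
  have -> : q = ((w *m U) *m A^C *m (w *m U) ^t*) 0 0.
    rewrite /q eqA trmx_mul map_mxM /= !mulmxA.
    rewrite -(mulmxA w U) UU mulmx1 -[w *m _ *m U *m _]mulmxA UU mulmx1.
    by [].
  pose z := w *m U; rewrite -/z.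
  have zl : z *m (l^C)^T = 0.
    by apply/matrixP => a b; rewrite !ord1 /z -mulmxA wc mxE.
  have -> : A^C = (l^C)^T *m l^C - (B^C)^T *m B^C.
    by rewrite !map_trmx -!map_mxM -map_mxB.
  clearbody z; rewrite mulmxBr mulmxBl mulmxA zl.
  rewrite !mul0mx add0r mxE oppr_le0.
  have -> : z *m ((B^C)^T *m B^C) *m z ^t* = z *m (B^C)^T *m (z *m (B^C)^T) ^t*.
    rewrite trmx_mul trmxK map_mxM /= !mulmxA; congr (_ *m _ *m _).
    by apply/matrixP => a b; rewrite !mxE conj_toC.
  rewrite mxE; apply: sumr_ge0 => k _.
  by rewrite [X in _ * X]mxE [X in _ * Num.conj X]mxE -normCK exprn_ge0.
by move=> /le_gtF; rewrite qpos.
Qed.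

End Spectral.

(** * Hyperbolic bilinear forms *)

Section Form.
Context {R : realType} {n : nat}.
Implicit Types (A B : 'M[R]_n) (x y z u v : 'rV[R]_n) (i j k : 'I_n).

Lemma bformDl A x y z : bform A (x + y) z = bform A x z + bform A y z.
Proof. by rewrite /bform !mulmxDl mxE. Qed.

Lemma bformZl A (c : R) x z : bform A (c *: x) z = c * bform A x z.
Proof. by rewrite /bform -!scalemxAl mxE. Qed.

Lemma bformDr A x y z : bform A z (x + y) = bform A z x + bform A z y.
Proof. by rewrite /bform linearD mulmxDr mxE. Qed.

Lemma bformZr A (c : R) x z : bform A z (c *: x) = c * bform A z x.
Proof. by rewrite /bform linearZ /= -scalemxAr mxE. Qed.

Lemma bformD A B x y : bform (A + B) x y = bform A x y + bform B x y.
Proof. by rewrite /bform mulmxDr mulmxDl mxE. Qed.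

Lemma bformZ A (c : R) x y : bform (c *: A) x y = c * bform A x y.
Proof. by rewrite /bform -scalemxAr -scalemxAl mxE. Qed.

Lemma bformC A x y : A^T = A -> bform A x y = bform A y x.
Proof.
move=> symA; have -> : bform A x y = ((x *m A *m y^T)^T) 0 0 by rewrite mxE.
by rewrite !trmx_mul trmxK symA mulmxA.
Qed.

Lemma bform_deltal A i x : bform A (delta_mx 0 i) x = (row i A *m x^T) 0 0.
Proof. by rewrite /bform -rowE. Qed.

Lemma bform_delta A i j : bform A (delta_mx 0 i) (delta_mx 0 j) = A i j.
Proof. by rewrite bform_deltal trmx_delta -colE !mxE. Qed.

Definition bformE := (bformDl, bformDr, bformZl, bformZr, bform_delta).

Lemma bform_line A x y (c : R) : A^T = A ->
  bform A (x + c *: y) (x + c *: y) =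
    bform A x x + 2 * c * bform A y x + c ^+ 2 * bform A y y.
Proof. by move=> symA; rewrite !bformE (bformC x y symA); ring. Qed.

(** Test hyperbolicity on the combination of [u] and [v] whose two parts pair equally with [y], drop
    the nonnegative diagonal terms, and divide by twice the product of [bform A y u] and
    [bform A y v]. *)
Lemma hyperbolic_pivot A y u v : A^T = A -> hyperbolic_at A y ->
  0 <= bform A y y -> 0 < bform A y u -> 0 < bform A y v ->
  0 <= bform A u u -> 0 <= bform A v v ->
  bform A y y * bform A u v <= 2 * (bform A y u * bform A y v).
Proof.
move=> symA hypA yy yu yv uu vv.
have := hypA (bform A y v *: u + bform A y u *: v).
rewrite !bformE (bformC v u symA).
move: (bform A y y) (bform A y u) (bform A y v) (bform A u u) (bform A v v)
  (bform A u v) yy yu yv uu vv => Y U V Q P W Y0 U0 V0 Q0 P0 h.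
have UV : 0 < U * V by rewrite mulr_gt0.
have e1 : 0 <= Y * (V ^+ 2 * Q) by rewrite mulr_ge0 // mulr_ge0 // sqr_ge0.
have e2 : 0 <= Y * (U ^+ 2 * P) by rewrite mulr_ge0 // mulr_ge0 // sqr_ge0.
rewrite -(ler_pM2l UV); nra.
Qed.

(** For [e < 0], the choice [K = - a / e] kills the right-hand side while the terms in [K] add up to
    something nonnegative. For [e = 0] the left side is affine in [K] and the right side constant,
    which is absurd unless [a = 0]. *)
Lemma nonpos_of_quadratic_family (X a r e c : R) : 0 < r -> e <= 0 ->
  (forall K, X + 2 * K * a * r + K ^+ 2 * e * r <= c * (a + K * e) ^+ 2) ->
  X <= 0.
Proof.
move=> r0; rewrite le_eqVlt => /orP[/eqP->|e0] h.
  have [a0|aN0] := eqVneq a 0; first by have := h 0; rewrite a0; lra.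
  have := h ((c * a ^+ 2 + 1 - X) / (2 * a * r)).
  have -> : 2 * ((c * a ^+ 2 + 1 - X) / (2 * a * r)) * a * r =
     c * a ^+ 2 + 1 - X by field; rewrite aN0 gt_eqF.
  lra.
have := h (- a / e).
have -> : a + - a / e * e = 0 by field; rewrite lt_eqF.
rewrite -addrA.
have -> : 2 * (- a / e) * a * r + (- a / e) ^+ 2 * e * r = a ^+ 2 * r * (- e^-1).
  by field; rewrite lt_eqF.
have : 0 <= a ^+ 2 * r * (- e^-1).
  rewrite mulr_ge0 //; first by rewrite mulr_ge0 ?sqr_ge0 // ltW.
  by rewrite oppr_ge0 invr_le0 ltW.
lra.
Qed.

(* Bochner's method.  Here [bform P (delta_mx 0 i) = bform A y] and
   [bform P (delta_mx 0 j) = bform B y] for [P = s A + t B], so that the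
   hypotheses bound [bform P z z] by
   [s (bform A y z)^2 / bform A y y + t (bform B y z)^2 / bform B y y].  For [z]
   orthogonal to [y], moving [z] along the vector [w] of the plane spanned by
   [e_i] and [e_j] that is orthogonal to [y] makes both squares vanish. *)
Lemma hyperbolic_add A B i j (s t : R) (y := s *: delta_mx 0 i + t *: delta_mx 0 j) :
  A^T = A -> B^T = B -> (forall k, A j k = B i k) ->
  0 < s -> 0 < t -> 0 < A i i -> 0 < A i j -> 0 < B i j -> 0 < B j j ->
  hyperbolic_at A y -> hyperbolic_at B y ->
  hyperbolic_at (s *: A + t *: B) y.
Proof.
move=> symA symB AB s0 t0 g0 g1 g2 g3 hA hB x.
set P := s *: A + t *: B.
have symP : P^T = P by rewrite linearD !linearZ /= symA symB.
have Aji : A j i = A i j by rewrite -[in RHS]symA mxE.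
have Bji : B j i = B i j by rewrite -[in RHS]symB mxE.
have rowAB z : bform A (delta_mx 0 j) z = bform B (delta_mx 0 i) z.
  rewrite !bform_deltal; congr ((_ *m _) 0 0).
  by apply/rowP => k; rewrite !mxE.
have Pi z : bform P (delta_mx 0 i) z = bform A y z.
  by rewrite /y bformD !bformZ bformDl !bformZl rowAB.
have Pj z : bform P (delta_mx 0 j) z = bform B y z.
  by rewrite /y bformD !bformZ bformDl !bformZl rowAB.
have Py z : bform P y z = s * bform A y z + t * bform B y z.
  by rewrite {1}/y bformDl !bformZl Pi Pj.
have Ajj : A j j = B i j by rewrite AB.
have Bii : B i i = A i j by rewrite -AB Aji.
have dA : A i i * B i j <= A i j ^+ 2.
  have := hA (delta_mx 0 i); rewrite /y !bformE Aji Ajj.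
  have t20 : 0 < t ^+ 2 by rewrite exprn_gt0.
  move=> h; rewrite -(ler_pM2l t20); nra.
have dB : A i j * B j j <= B i j ^+ 2.
  have := hB (delta_mx 0 j); rewrite /y !bformE Bji Bii.
  have s20 : 0 < s ^+ 2 by rewrite exprn_gt0.
  move=> h; rewrite -(ler_pM2l s20); nra.
have dAB : A i i * B j j <= A i j * B i j.
  have g12 : 0 < A i j * B i j by rewrite mulr_gt0.
  rewrite -(ler_pM2l g12).
  have : (A i i * B i j) * (A i j * B j j) <= A i j ^+ 2 * B i j ^+ 2.
    by apply: ler_pM; rewrite // mulr_ge0 // ltW.
  nra.
have Pii : P i i = s * A i i + t * A i j by rewrite !mxE Bii.
have Pij : P i j = s * A i j + t * B i j by rewrite !mxE.
have Pji : P j i = P i j by rewrite !mxE Aji Bji.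
have Pjj : P j j = s * B i j + t * B j j by rewrite !mxE Ajj.
have dP : P i i * P j j <= P i j ^+ 2.
  rewrite Pii Pij Pjj -subr_ge0.
  have -> : (s * A i j + t * B i j) ^+ 2 -
     (s * A i i + t * A i j) * (s * B i j + t * B j j) =
     s ^+ 2 * (A i j ^+ 2 - A i i * B i j) + t ^+ 2 * (B i j ^+ 2 - A i j * B j j)
     + s * t * (A i j * B i j - A i i * B j j) by ring.
  by rewrite !addr_ge0 // mulr_ge0 ?sqr_ge0 ?subr_ge0 // mulr_ge0 // ltW.
have Pii0 : 0 < P i i by rewrite Pii addr_gt0 // mulr_gt0.
have Pij0 : 0 < P i j by rewrite Pij addr_gt0 // mulr_gt0.
have Pjj0 : 0 < P j j by rewrite Pjj addr_gt0 // mulr_gt0.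
have ay0 : 0 < bform A y y.
  by rewrite /y !bformE Aji Ajj !(addr_gt0, mulr_gt0).
have by0 : 0 < bform B y y.
  by rewrite /y !bformE Bji Bii !(addr_gt0, mulr_gt0).
have Pyy0 : 0 < bform P y y by rewrite Py addr_gt0 // mulr_gt0.
(* A multiple of the component of [x] orthogonal to [y]; [bform P z z] is [bform P y y] times the
   difference to be bounded. *)
pose z := bform P y y *: x - bform P y x *: y.
have zE (M : 'M[R]_n) w :
    bform M w z = bform P y y * bform M w x - bform P y x * bform M w y.
  by rewrite /z -scaleNr !bformE; ring.
have Pyz : bform P y z = 0 by rewrite zE; ring.
suff Pzz : bform P z z <= 0.
  rewrite -subr_le0 -(pmulr_rle0 _ Pyy0) (le_trans _ Pzz) //.
  rewrite zE !(bformC z) // !zE [bform P x y]bformC //.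
  by rewrite le_eqVlt; apply/orP; left; apply/eqP; ring.
(* [p] and [q] are the pairings of [y] with [e_j] and [e_i] under [P], which makes [w] below
   orthogonal to [y]. *)
pose p := s * P i j + t * P j j.
pose q := s * P i i + t * P i j.
have p0 : 0 < p by rewrite addr_gt0 // mulr_gt0.
have q0 : 0 < q by rewrite addr_gt0 // mulr_gt0.
pose w := p *: delta_mx 0 i - q *: delta_mx 0 j : 'rV[R]_n.
have wE (v : 'rV[R]_n) : bform P w v = p * bform A y v - q * bform B y v.
  by rewrite /w -scaleNr bformDl !bformZl Pi Pj mulNr.
have Pyw : bform P y w = 0.
  by rewrite /y /w -scaleNr !bformE Pji /p /q; ring.
(* On the complement of [y], [bform A y] and [bform B y] are proportional with ratio [- s / t], so
   pairing with [w] is [r] times [bform A y]. *)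
pose r := p + q * s / t.
have r0 : 0 < r by rewrite addr_gt0 // divr_gt0 // mulr_gt0.
have perp v : bform P y v = 0 -> bform B y v = - (s / t * bform A y v).
  rewrite Py => /eqP; rewrite addr_eq0 => /eqP h.
  by apply: (mulfI (lt0r_neq0 t0)); rewrite -[LHS]opprK -h; field; rewrite gt_eqF.
have wE' v : bform P y v = 0 -> bform P w v = r * bform A y v.
  by move=> /perp; rewrite wE => ->; rewrite /r; field; rewrite gt_eqF.
have Pww : bform P w w = bform P y y * (P i i * P j j - P i j ^+ 2).
  by rewrite /w /y -scaleNr !bformE Pji /p /q; ring.
have Aw0 : bform A y w <= 0.
  by rewrite -(pmulr_rle0 _ r0) -wE' // Pww pmulr_rle0 // subr_le0.
clearbody z w.
(* The constant for which, on the complement of [y], the sum of the two hyperbolicity bounds is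
   [c * bform A y v ^+ 2]. *)
pose c := s / bform A y y + s ^+ 2 / t / bform B y y.
apply: (@nonpos_of_quadratic_family _ (bform A y z) r (bform A y w) c) => // K.
have -> : bform P z z + 2 * K * bform A y z * r + K ^+ 2 * bform A y w * r =
    bform P (z + K *: w) (z + K *: w).
  by rewrite bform_line // !wE' //; ring.
set v := z + K *: w.
have -> : bform A y z + K * bform A y w = bform A y v by rewrite /v bformDr bformZr.
have Pyv : bform P y v = 0 by rewrite /v bformDr bformZr Pyz Pyw; ring.
have : bform A v v <= bform A y v ^+ 2 / bform A y y.
  by rewrite ler_pdivlMr // mulrC; apply: hA.
have : bform B v v <= bform B y v ^+ 2 / bform B y y.
  by rewrite ler_pdivlMr // mulrC; apply: hB.
rewrite (perp _ Pyv) => hb ha.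
apply: le_trans (_ : s * (bform A y v ^+ 2 / bform A y y) +
   t * ((- (s / t * bform A y v)) ^+ 2 / bform B y y) <= _).
  by rewrite bformD !bformZ lerD // ler_pM2l.
rewrite le_eqVlt; apply/orP; left; apply/eqP; rewrite /c; field.
by rewrite !gt_eqF.
Qed.

End Form.

(** * Symmetric quartic tensors *)

Section RatioBound.
Context {R : realType}.
Implicit Types A B C p q h x M g : R.

(** Here [a_ij] stands for the 4-linear form with [i] arguments [u], [j] arguments [v] and the
    others [y]. In the product of the four local inequalities all factors but the outer ones cancel,
    and 16 is the fourth power of 2. *)
Lemma mul_telescope (a00 a10 a01 a11 a20 a02 a21 a12 a22 : R) :
  0 < a10 -> 0 < a01 -> 0 < a11 -> 0 < a21 -> 0 < a12 -> 0 <= a00 -> 0 <= a22 ->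
  a00 * a11 <= 2 * (a10 * a01) -> a10 * a21 <= 2 * (a20 * a11) ->
  a01 * a12 <= 2 * (a11 * a02) -> a11 * a22 <= 2 * (a21 * a12) ->
  a00 * a22 <= 16 * (a20 * a02).
Proof.
move=> h10 h01 h11 h21 h12 h00 h22 e1 e2 e3 e4.
have pos : 0 < a11 * a11 * (a10 * a21 * (a01 * a12)).
  by rewrite !mulr_gt0.
rewrite -(ler_pM2l pos).
have f1 : (a00 * a11) * (a11 * a22) <= (2 * (a10 * a01)) * (2 * (a21 * a12)).
  by apply: ler_pM; rewrite // mulr_ge0 // ltW.
have f2 : (a10 * a21) * (a01 * a12) <= (2 * (a20 * a11)) * (2 * (a11 * a02)).
  by apply: ler_pM; rewrite // mulr_ge0 // ltW.
have f3 : (a00 * a11 * (a11 * a22)) * ((a10 * a21) * (a01 * a12)) <=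
   ((2 * (a10 * a01)) * (2 * (a21 * a12))) * ((2 * (a20 * a11)) * (2 * (a11 * a02))).
  by apply: ler_pM; rewrite // !mulr_ge0 // ltW.
rewrite (_ : _ * (a00 * a22) =
   (a00 * a11 * (a11 * a22)) * ((a10 * a21) * (a01 * a12))); last by ring.
by rewrite (le_trans f3) // le_eqVlt; apply/orP; left; apply/eqP; ring.
Qed.

(** The conclusion asks for [x] above [A / B] and [p / (4 * h)] and below [B / C] and [4 * h / q].
    The hypotheses put each lower bound below each upper bound, so the larger lower bound works. *)
Lemma balanced_scale A B C p q h :
  0 < A -> 0 < B -> 0 < h -> 0 < p -> 0 < q ->
  A * C <= B ^+ 2 -> A * q <= 4 * (B * h) -> C * p <= 4 * (B * h) ->
  p * q <= h ^+ 2 ->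
  exists x, [/\ 0 < x, A <= B * x, C * x <= B, p <= 4 * h * x & q * x <= 4 * h].
Proof.
move=> A0 B0 h0 p0 q0 AC Aq Cp pq.
have h40 : 0 < 4 * h by lra.
have [le|lt] := leP (p / (4 * h)) (A / B).
  exists (A / B); split.
  - by rewrite divr_gt0.
  - by rewrite mulrCA divff ?mulr1 // gt_eqF.
  - by rewrite mulrA ler_pdivrMr // mulrC -expr2.
  - by rewrite mulrC -ler_pdivrMr.
  - by rewrite mulrA ler_pdivrMr //; lra.
exists (p / (4 * h)); split.
- by rewrite divr_gt0.
- by rewrite mulrC -ler_pdivrMr // ltW.
- by rewrite mulrA ler_pdivrMr //; lra.
- by rewrite mulrCA divff ?mulr1 // gt_eqF.
- by rewrite mulrA ler_pdivrMr //; nra.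
Qed.

(** Evaluate at the geometric mean [t] of the scales [x] and [x']: the two quadratic factors are
    then at most [B] and [B'] times the same sum [x + x' + 2 * t]. *)
Lemma quartic_ratio_bound A B C A' B' C' p q h M :
  0 < A -> 0 < B -> 0 < C -> 0 < A' -> 0 < B' -> 0 < C' ->
  0 < p -> 0 < q -> 0 < h -> 0 < M ->
  A * C <= B ^+ 2 -> A' * C' <= B' ^+ 2 ->
  A * q <= 4 * (B * h) -> C * p <= 4 * (B * h) ->
  A' * q <= 4 * (B' * h) -> C' * p <= 4 * (B' * h) -> p * q <= h ^+ 2 ->
  (forall t, 0 < t ->
     M * (4 * t * p + 6 * t ^+ 2 * h + 4 * t ^+ 3 * q) <=
     16 * ((A + 2 * t * B + t ^+ 2 * C) * (A' + 2 * t * B' + t ^+ 2 * C'))) ->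
  M * (p * q) <= 64 * (h * (B * B')).
Proof.
move=> A0 B0 C0 A'0 B'0 C'0 p0 q0 h0 M0 AC A'C' Aq Cp A'q C'p pq hM.
have [x [x0 Ax Cx px qx]] := balanced_scale A0 B0 h0 p0 q0 AC Aq Cp pq.
have [x' [x'0 Ax' Cx' px' qx']] := balanced_scale A'0 B'0 h0 p0 q0 A'C' A'q C'p pq.
pose t := Num.sqrt (x * x'); pose g := Num.sqrt (p * q).
have t2 : t ^+ 2 = x * x' by rewrite sqr_sqrtr // mulr_ge0 // ltW.
have g2 : g ^+ 2 = p * q by rewrite sqr_sqrtr // mulr_ge0 // ltW.
have t0 : 0 < t by rewrite sqrtr_gt0 mulr_gt0.
have g0 : 0 < g by rewrite sqrtr_gt0 mulr_gt0.
have gh : g <= h by rewrite -(@ler_pXn2r _ 2%N) ?nnegrE ?g2 // ltW.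
have hMt := hM t t0.
have amgm : 2 * t * g <= p + t ^+ 2 * q.
  rewrite -(@ler_pXn2r _ 2) ?nnegrE //; last 2 first.
  - by rewrite !mulr_ge0 // ltW.
  - by rewrite addr_ge0 ?mulr_ge0 ?sqr_ge0 // ltW.
  rewrite 2!exprMn g2 -subr_ge0.
  rewrite (_ : _ - _ = (p - t ^+ 2 * q) ^+ 2); last by ring.
  exact: sqr_ge0.
have BBt : 0 < B * B' by rewrite mulr_gt0.
have s1 : M * t ^+ 2 * (6 * h + 8 * g) <= 16 * (B * B') * (x + x' + 2 * t) ^+ 2.
  have u1 : A + 2 * t * B + t ^+ 2 * C <= B * (x + x' + 2 * t).
    have : t ^+ 2 * C <= B * x'.
      by rewrite t2 mulrAC [x * C]mulrC ler_pM2r.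
    lra.
  have u2 : A' + 2 * t * B' + t ^+ 2 * C' <= B' * (x + x' + 2 * t).
    have : t ^+ 2 * C' <= B' * x.
      by rewrite t2 -mulrA mulrC [x' * C']mulrC ler_pM2r.
    lra.
  have u3 : M * t ^+ 2 * (6 * h + 8 * g) <=
      M * (4 * t * p + 6 * t ^+ 2 * h + 4 * t ^+ 3 * q).
    rewrite -mulrA ler_pM2l //.
    have : 4 * t * (2 * t * g) <= 4 * t * (p + t ^+ 2 * q).
      by rewrite ler_pM2l // mulr_gt0.
    lra.
  apply: le_trans u3 (le_trans hMt _).
  rewrite -[leRHS]mulrA ler_pM2l //.
  rewrite (_ : B * B' * _ = (B * (x + x' + 2 * t)) * (B' * (x + x' + 2 * t)));
    last by ring.
  by apply: ler_pM; rewrite // !addr_ge0 ?mulr_ge0 ?sqr_ge0 // ltW.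
(* The bounds on [p] and [q] keep the ratio of [x] to [x'] between [g ^+ 2 / (16 * h ^+ 2)] and its
   inverse; multiplying the two estimates bounds the arithmetic mean by the geometric one. *)
have s2 : 4 * h * g * (x + x') <= t * (16 * h ^+ 2 + g ^+ 2).
  have y1 : 0 <= 16 * h ^+ 2 * x - g ^+ 2 * x'.
    have : p * (q * x') <= 4 * h * x * (4 * h).
      by apply: ler_pM; rewrite // ltW // mulr_gt0.
    by rewrite g2; lra.
  have y2 : 0 <= 16 * h ^+ 2 * x' - g ^+ 2 * x.
    have : p * (q * x) <= 4 * h * x' * (4 * h).
      by apply: ler_pM; rewrite // ltW // mulr_gt0.
    by rewrite g2; lra.
  rewrite -(@ler_pXn2r _ 2) ?nnegrE //; last 2 first.
  - by rewrite !mulr_ge0 ?addr_ge0 // ltW.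
  - by rewrite mulr_ge0 ?addr_ge0 ?mulr_ge0 ?sqr_ge0 // ltW.
  rewrite [leRHS]exprMn t2 -subr_ge0.
  by have := mulr_ge0 y1 y2; congr (0 <= _); ring.
(* This is where 64 suffices: for [g <= h], [g ^+ 2 <= h * g] reduces the claim to a comparison of
   quadratics. *)
have s3 : (16 * h ^+ 2 + 8 * h * g + g ^+ 2) ^+ 2 <= 64 * h ^+ 3 * (6 * h + 8 * g).
  apply: (@le_trans _ _ ((h * (16 * h + 9 * g)) ^+ 2)).
    rewrite ler_pXn2r ?nnegrE //; first by nra.
    - by rewrite !addr_ge0 ?mulr_ge0 ?sqr_ge0 // ltW.
    - by rewrite mulr_ge0 ?addr_ge0 ?mulr_ge0 // ltW.
  rewrite exprMn (_ : 64 * _ * _ = h ^+ 2 * (h * (384 * h + 512 * g))); last by ring.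
  by rewrite ler_pM2l ?exprn_gt0 //; nra.
have W0 : 0 < 16 * (h * h) * (6 * h + 8 * g) * t ^+ 2.
  by rewrite !mulr_gt0 ?addr_gt0 ?mulr_gt0 ?exprn_gt0.
rewrite -g2 -(ler_pM2l W0).
have s4 : (4 * h * g * (x + x' + 2 * t)) ^+ 2 <=
    (t * (16 * h ^+ 2 + 8 * h * g + g ^+ 2)) ^+ 2.
  rewrite ler_pXn2r ?nnegrE //; first by lra.
  - by rewrite mulr_ge0 // ?addr_ge0 ?mulr_ge0 // ltW.
  - by rewrite mulr_ge0 ?addr_ge0 ?mulr_ge0 ?sqr_ge0 // ltW.
have s5 : (4 * h * g) ^+ 2 * (M * t ^+ 2 * (6 * h + 8 * g)) <=
   (4 * h * g) ^+ 2 * (16 * (B * B') * (x + x' + 2 * t) ^+ 2).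
  by rewrite ler_pM2l ?exprn_gt0 ?mulr_gt0.
have s6 : 16 * (B * B') * (4 * h * g * (x + x' + 2 * t)) ^+ 2 <=
    16 * (B * B') * (t * (16 * h ^+ 2 + 8 * h * g + g ^+ 2)) ^+ 2.
  by rewrite ler_pM2l // mulr_gt0.
have s7 : 16 * (B * B') * t ^+ 2 * (16 * h ^+ 2 + 8 * h * g + g ^+ 2) ^+ 2 <=
    16 * (B * B') * t ^+ 2 * (64 * h ^+ 3 * (6 * h + 8 * g)).
  by rewrite ler_pM2l // !mulr_gt0 // exprn_gt0.
lra.
Qed.

End RatioBound.

(** * Positive symmetric 4-tensors with hyperbolic slices *)

Section Tensor.
Context {R : realType} {n : nat}.
Variable c : 'I_n -> 'I_n -> 'I_n -> 'I_n -> R.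
Hypothesis c12 : forall i j k l, c i j k l = c j i k l.
Hypothesis c23 : forall i j k l, c i j k l = c i k j l.
Hypothesis c34 : forall i j k l, c i j k l = c i j l k.
Hypothesis c_gt0 : forall i j k l, 0 < c i j k l.
Let H i j : 'M[R]_n := \matrix_(k, l) c i j k l.
Hypothesis H_hyp : forall i j y, 0 < bform (H i j) y y -> hyperbolic_at (H i j) y.

Let symH i j : (H i j)^T = H i j.
Proof. by apply/matrixP => k l; rewrite !mxE c34. Qed.

Let e i : 'rV[R]_n := delta_mx 0 i.

Let hyp_e i j k : hyperbolic_at (H i j) (e k).
Proof. by apply: H_hyp; rewrite bform_delta mxE. Qed.

Lemma tensor_logconcave i j k l : c i j k k * c i j l l <= c i j k l ^+ 2.
Proof. by have := hyp_e i j k (e l); rewrite !bform_delta !mxE. Qed.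

Lemma tensor_pivot i j k l m : c i j k k * c i j l m <= 2 * (c i j k l * c i j k m).
Proof.
have := @hyperbolic_pivot R n (H i j) (e k) (e l) (e m) (symH i j) (@hyp_e i j k).
by rewrite !bform_delta !mxE; apply; rewrite // ltW.
Qed.

Lemma tensor_exchange a b u : c a a u u * c a b b b <= 4 * (c a b u u * c a a b b).
Proof.
have h1 := tensor_pivot a b b a u.
have h2 := tensor_pivot a u b a u.
have e1 : c a b b a = c a a b b by rewrite c34 c23.
have e2 : c a b a u = c a a b u by rewrite c23.
have e3 : c a u b b = c a b b u by rewrite c23 c34.
have e4 : c a u a u = c a a u u by rewrite c23.
have e5 : c a u b a = c a a b u by rewrite c34 c23 c34.
have e6 : c a u b u = c a b u u by rewrite c23.
rewrite e1 e2 in h1; rewrite e3 e4 e5 e6 in h2.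
have pos : 0 < c a a b u * c a b b u by rewrite mulr_gt0.
rewrite -(ler_pM2l pos).
have : (c a b b b * c a a b u) * (c a b b u * c a a u u) <=
    (2 * (c a a b b * c a b b u)) * (2 * (c a a b u * c a b u u)).
  by apply: ler_pM; rewrite // mulr_ge0 // ltW.
lra.
Qed.

(** [Q i] and [P] below are the forms F(e_i, y, -, -) and F(y, y, -, -), each obtained from the
    previous level by [hyperbolic_add]; pivoting at [y] on all levels feeds [mul_telescope]. *)
Lemma tensor_reverseKT a b u v (t : R) : 0 < t ->
  c u u v v * (c a a a a + 4 * t * c a a a b + 6 * t ^+ 2 * c a a b b
    + 4 * t ^+ 3 * c a b b b + t ^+ 4 * c b b b b) <=
  16 * ((c a a u u + 2 * t * c a b u u + t ^+ 2 * c b b u u) *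
        (c a a v v + 2 * t * c a b v v + t ^+ 2 * c b b v v)).
Proof.
move=> t0; pose y := e a + t *: e b.
have s0 : 0 < 1 :> R by [].
have yE : y = 1 *: e a + t *: e b by rewrite scale1r.
have pos (M : 'M[R]_n) : (forall i j, 0 < M i j) ->
    [/\ 0 < bform M y y, forall i, 0 < bform M y (e i)
      & forall i j, 0 < bform M (e i) (e j)].
  move=> M0; split=> [|i|i j]; rewrite ?yE !bformE //.
    by rewrite !addr_gt0 ?mulr_gt0 ?addr_gt0 ?mulr_gt0.
  by rewrite !addr_gt0 ?mulr_gt0.
have H0 i j k l : 0 < H i j k l by rewrite mxE.
have Hy i j : hyperbolic_at (H i j) y by apply: H_hyp; case: (pos _ (H0 i j)).
pose Q i := 1 *: H i a + t *: H i b.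
have Q0 i k l : 0 < Q i k l by rewrite !mxE addr_gt0 ?mulr_gt0.
have symQ i : (Q i)^T = Q i by rewrite linearD !linearZ /= !symH.
have Qhyp i : hyperbolic_at (Q i) y.
  rewrite yE; apply: hyperbolic_add; rewrite ?symH -?yE //.
  by move=> k; rewrite !mxE c23.
pose P := 1 *: Q a + t *: Q b.
have P0 k l : 0 < P k l.
  have -> : P k l = 1 * Q a k l + t * Q b k l by rewrite !mxE.
  by rewrite addr_gt0 ?mulr_gt0.
have symP : P^T = P by rewrite linearD !linearZ /= !symQ.
have Phyp : hyperbolic_at P y.
  rewrite yE; apply: hyperbolic_add; rewrite ?symQ -?yE //.
  by move=> k; rewrite !mxE (c12 b a) (c23 b b) (c12 b a b) (c23 a a) (c23 a b); ring.
have piv (M : 'M[R]_n) : (forall i j, 0 < M i j) -> M^T = M -> hyperbolic_at M y ->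
   bform M y y * M u v <= 2 * (bform M y (e u) * bform M y (e v)).
  move=> M0 symM hM; have [yy yi ij] := pos M M0.
  rewrite -bform_delta; apply: hyperbolic_pivot => //; exact: ltW.
have h00 := piv _ P0 symP Phyp.
have h10 := piv _ (Q0 u) (symQ u) (Qhyp u).
have h01 := piv _ (Q0 v) (symQ v) (Qhyp v).
have h11 := piv _ (H0 u v) (symH u v) (Hy u v).
have HE i j k l : H i j k l = c i j k l by rewrite mxE.
have QE i k l : Q i k l = c i a k l + t * c i b k l by rewrite !mxE mul1r.
have PE k l : P k l = c a a k l + 2 * t * c a b k l + t ^+ 2 * c b b k l.
  have -> : P k l = 1 * Q a k l + t * Q b k l by rewrite !mxE.
  by rewrite !QE (c12 b a); ring.
(* Each rule swaps one adjacent pair into the order [a], [b], [u], [v], so that rewriting sorts the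
   indices and terminates. *)
have canon := ((c12 b a, c12 u a, c12 v a, c12 u b, c12 v b, c12 v u),
  ((fun x => c23 x b a), (fun x => c23 x u a), (fun x => c23 x v a),
   (fun x => c23 x u b), (fun x => c23 x v b), (fun x => c23 x v u)),
  ((fun x y => c34 x y b a), (fun x y => c34 x y u a),
   (fun x y => c34 x y v a), (fun x y => c34 x y u b),
   (fun x y => c34 x y v b), (fun x y => c34 x y v u))).
rewrite yE !bformE !PE !canon in h00.
rewrite yE !bformE !QE !canon in h10.
rewrite yE !bformE !QE !canon in h01.
rewrite yE !bformE !HE !canon in h11.
rewrite mulrC.
apply: (@mul_telescope _ _ (c a a a u + 3 * t * c a a b u + 3 * t ^+ 2 * c a b b u
                         + t ^+ 3 * c b b b u)
  (c a a a v + 3 * t * c a a b v + 3 * t ^+ 2 * c a b b v + t ^+ 3 * c b b b v)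
  (c a a u v + 2 * t * c a b u v + t ^+ 2 * c b b u v) _ _
  (c a u u v + t * c b u u v) (c a u v v + t * c b u v v)).
- by rewrite !(addr_gt0, mulr_gt0, exprn_gt0).
- by rewrite !(addr_gt0, mulr_gt0, exprn_gt0).
- by rewrite !(addr_gt0, mulr_gt0, exprn_gt0).
- by rewrite !(addr_gt0, mulr_gt0, exprn_gt0).
- by rewrite !(addr_gt0, mulr_gt0, exprn_gt0).
- by rewrite ltW // !(addr_gt0, mulr_gt0, exprn_gt0).
- by rewrite ltW.
- lra.
- lra.
- lra.
- lra.
Qed.

End Tensor.

Lemma tensor_ratio_bound (R : realType) n (c : 'I_n -> 'I_n -> 'I_n -> 'I_n -> R) :
  (forall i j k l, c i j k l = c j i k l) ->
  (forall i j k l, c i j k l = c i k j l) ->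
  (forall i j k l, c i j k l = c i j l k) ->
  (forall i j k l, 0 < c i j k l) ->
  (forall i j y, let H := \matrix_(k, l) c i j k l in
     0 < bform H y y -> hyperbolic_at H y) ->
  forall a b u v,
    c u u v v * (c a a a b * c a b b b) <= 64 * (c a a b b * (c a b u u * c a b v v)).
Proof.
move=> c12 c23 c34 c0 hyp a b u v.
have lc := tensor_logconcave c0 hyp.
have ex := tensor_exchange c12 c23 c34 c0 hyp.
have c1324 x y z w : c x y z w = c z w x y by rewrite c23 c12 c34 c23 c12 c34 c23.
apply: (@quartic_ratio_bound _ (c a a u u) (c a b u u) (c b b u u)
  (c a a v v) (c a b v v) (c b b v v)) => //.
- by have := lc u u a b; rewrite ![c u u _ _]c1324.
- by have := lc v v a b; rewrite ![c v v _ _]c1324.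
- have := ex b a u; rewrite (c12 b a u u) (c1324 b b a a).
  by rewrite (_ : c b a a a = c a a a b) // c12 c23 c34.
- have := ex b a v; rewrite (c12 b a v v) (c1324 b b a a).
  by rewrite (_ : c b a a a = c a a a b) // c12 c23 c34.
- have := lc a b a b; rewrite (_ : c a b a a = c a a a b); last by rewrite c23 c34.
  by rewrite (_ : c a b a b = c a a b b) // c23.
move=> t t0.
have := tensor_reverseKT c12 c23 c34 c0 hyp a b u v t0.
apply: le_trans; rewrite ler_pM2l //.
(* The two extreme terms of F(y, y, y, y) are positive and are dropped. *)
have t40 : 0 <= t ^+ 4 * c b b b b by rewrite mulr_ge0 ?exprn_ge0 ?ltW.
have := c0 a a a a; lra.
Qed.

(** * The upper bound *)

Lemma mnm_addAC n : right_commutative (@mnm_add n).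
Proof. by move=> a b c; rewrite -!mpoly.addmA [mnm_add b c]mpoly.addmC. Qed.

Lemma lorentzian_quartic_ratio (R : realType) n (f : {mpoly R[n]}) :
  (forall a, mdeg a = 4%N -> 0 < ncoef f a) ->
  (forall b, mdeg b = 2%N -> at_most_one_pos_eigenvalue (hessian f b)) ->
  let c i j k l := ncoef f (U_(i) + U_(j) + U_(k) + U_(l))%MM in
  forall a b u v,
    c u u v v * (c a a a b * c a b b b) <= 64 * (c a a b b * (c a b u u * c a b v v)).
Proof.
move=> pos hess c; apply: tensor_ratio_bound => [i j k l|i j k l|i j k l|i j k l|i j y].
- by rewrite /c [(U_(i) + U_(j))%MM]mpoly.addmC.
- by rewrite /c [(U_(i) + U_(j) + U_(k))%MM]mnm_addAC.
- by rewrite /c [(_ + U_(k) + U_(l))%MM]mnm_addAC.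
- by apply: pos; rewrite !mdegD !mdeg1.
have -> : \matrix_(k, l) c i j k l = hessian f (U_(i) + U_(j))%MM.
  by apply/matrixP => k l; rewrite !mxE.
move=> H; apply: at_most_one_pos_hyperbolic.
  by apply/matrixP => k l; rewrite !mxE mnm_addAC.
by apply: hess; rewrite mdegD !mdeg1.
Qed.

Lemma ord4_ind (P : 'I_4 -> Prop) : P 0 -> P 1 -> P 2 -> P 3 -> forall i, P i.
Proof.
move=> P0 P1 P2 P3 [[|[|[|[|//]]]] lti].
- by rewrite (_ : Ordinal lti = 0) //; apply: val_inj.
- by rewrite (_ : Ordinal lti = 1) //; apply: val_inj.
- by rewrite (_ : Ordinal lti = 2) //; apply: val_inj.
- by rewrite (_ : Ordinal lti = 3) //; apply: val_inj.
Qed.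

Lemma mon4E (i j k l : 'I_4)
    (cnt := fun m : 'I_4 => ((i == m) + (j == m) + (k == m) + (l == m))%N) :
  mon4 (cnt 0) (cnt 1) (cnt 2) (cnt 3) = (U_(i) + U_(j) + U_(k) + U_(l))%MM.
Proof.
apply/mnmP; apply: ord4_ind;
  by rewrite !mnmDE !mnm1E multinomE (tnth_nth 0%N).
Qed.

Lemma mdeg_mon4 (p q r s : nat) : mdeg (mon4 p q r s) = (p + q + r + s)%N.
Proof.
rewrite mdegE !big_ord_recl big_ord0 !multinomE !(tnth_nth 0%N) /=.
by rewrite addn0 !addnA.
Qed.

Lemma R4_le64 (R : realType) (f : {mpoly R[4]}) :
  lorentzian_pos 4 (Delta 4 4) f -> R4 f <= 64%:R.
Proof.
move=> [[_ _ _ _ hess] pos].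
have pos4 a : mdeg a = 4%N -> 0 < ncoef f a.
  by move=> da; apply/pos; rewrite in_Delta da.
have hess2 b : mdeg b = 2%N -> at_most_one_pos_eigenvalue (hessian f b).
  by move=> db; apply: hess; rewrite db.
(* Indices count from 0: [y] lives on the first and third variables, [u] and [v] are the second and
   fourth. *)
have := lorentzian_quartic_ratio pos4 hess2 0 2 1 3.
rewrite -!mon4E => h.
have mpos (p q r s : nat) : (p + q + r + s = 4)%N -> 0 < ncoef f (mon4 p q r s).
  by move=> e; apply: pos4; rewrite mdeg_mon4.
rewrite /R4 ler_pdivrMr; last first.
  by apply: mulr_gt0; [apply: mulr_gt0|]; apply: mpos.
have {}h : (ncoef f (mon4 0 2 0 2) * (ncoef f (mon4 3 0 1 0) * ncoef f (mon4 1 0 3 0))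
  <= 64 * (ncoef f (mon4 2 0 2 0) *
           (ncoef f (mon4 1 2 1 0) * ncoef f (mon4 1 0 1 2)))) := h.
lra.
Qed.

(** * The ratio as a monomial with exponent vector [w4] *)

Lemma big_fset_support (T : Type) (idx : T) (op : Monoid.com_law idx)
    (K : choiceType) (S : {fset K}) (s : seq K) (g : K -> T) :
  uniq s -> {subset s <= S} -> (forall a, a \notin s -> g a = idx) ->
  \big[op/idx]_(a : S) g (val a) = \big[op/idx]_(a <- s) g a.
Proof.
move=> us sS g0; transitivity (\big[op/idx]_(a <- S) g a).
  by rewrite big_seq_fsetE.
rewrite (bigID (mem s)) /=.
rewrite [X in op _ X]big1 => [|a /g0 //]; rewrite Monoid.mulm1 -big_filter.
apply: perm_big; apply: uniq_perm; rewrite ?filter_uniq ?fset_uniq //.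
by move=> a; rewrite mem_filter; apply: andb_idr => /sS.
Qed.

Definition w4_num := [:: mon4 1 0 3 0; mon4 3 0 1 0; mon4 0 2 0 2].
Definition w4_den := [:: mon4 2 0 2 0; mon4 1 0 1 2; mon4 1 2 1 0].

Lemma mon4_inj p q r s p' q' r' s' :
  (mon4 p q r s == mon4 p' q' r' s') = [&& p == p', q == q', r == r' & s == s'].
Proof.
rewrite /mon4 -(inj_eq val_inj) /= -(inj_eq val_inj) /=.
by rewrite !eqseq_cons eqxx andbT.
Qed.

Lemma uniq_w4_support : uniq (w4_num ++ w4_den).
Proof. by rewrite /w4_num /w4_den [cat _ _]/= !cons_uniq !inE !mon4_inj. Qed.

Lemma w4_support_sub : {subset w4_num ++ w4_den <= Delta 4 4}.
Proof.
apply/allP; rewrite /w4_num /w4_den [cat _ _]/=.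
by rewrite /all !in_Delta !mdeg_mon4.
Qed.

Definition w4_fun (R : realType) (a : 'X_{1..4}) : R :=
  if a \in w4_num then 1 else if a \in w4_den then -1 else 0.

Lemma w4E (R : realType) (a : Delta 4 4) : w4 R a = w4_fun R (val a).
Proof. by rewrite ffunE. Qed.

Lemma w4_fun0 (R : realType) a : a \notin w4_num ++ w4_den -> w4_fun R a = 0.
Proof. by rewrite mem_cat negb_or /w4_fun => /andP[/negPf-> /negPf->]. Qed.

Lemma w4_fun_num (R : realType) a : a \in w4_num -> w4_fun R a = 1.
Proof. by rewrite /w4_fun => ->. Qed.

Lemma w4_fun_den (R : realType) a : a \in w4_den -> w4_fun R a = -1.
Proof.
have := uniq_w4_support; rewrite cat_uniq => /and3P[_ /hasPn h _] ad.
by rewrite /w4_fun (negPf (h _ ad)) ad.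
Qed.

Lemma coef_ratio_w4 (R : realType) (f : {mpoly R[4]}) :
  (forall a, 0 <= ncoef f a) -> coef_ratio (w4 R) f = R4 f.
Proof.
move=> f0; rewrite /coef_ratio.
under eq_bigr do rewrite w4E.
rewrite (big_fset_support _ (g := fun a => ncoef f a `^ w4_fun R a)
  uniq_w4_support w4_support_sub); last first.
  by move=> a /(w4_fun0 R) ->; rewrite powRr0.
rewrite big_cat /= (eq_big_seq (ncoef f)) => [|a /w4_fun_num->]; last first.
  by rewrite powRr1.
rewrite [X in _ * X](eq_big_seq (fun a => (ncoef f a)^-1)) => [|a /w4_fun_den->];
  last first.
  by rewrite powR_inv1.
rewrite !big_cons !big_nil /R4.
move: (ncoef f (mon4 1 0 3 0)) (ncoef f (mon4 3 0 1 0)) (ncoef f (mon4 0 2 0 2))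
  (ncoef f (mon4 2 0 2 0)) (ncoef f (mon4 1 0 1 2)) (ncoef f (mon4 1 2 1 0)) => *.
by rewrite !invfM !mulr1 !mulrA.
Qed.

Lemma w4_BR (R : realType) : BR 4 (Delta 4 4) (w4 R).
Proof.
apply: (@le_lt_trans _ _ (64%:R)%:E); last by rewrite ltry.
apply: ge_ereal_sup => _ [f fL <-].
rewrite lee_fin coef_ratio_w4; first exact: R4_le64.
by have [[]] := fL.
Qed.

(** * Bounded ratios of quadratic forms *)

Lemma mdegS_split n d (a : 'X_{1..n}) : mdeg a = d.+1 ->
  exists i b, a = (b + U_(i))%MM /\ mdeg b = d.
Proof.
move=> da.
have /existsP[i ai] : [exists i, a i != 0%N].
  apply: contraPT da; rewrite negb_exists => /forallP a0.
  suff -> : a = 0%MM by rewrite mdeg0.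
  by apply/mnmP => i; rewrite mnm0E; apply/eqP/negPn/a0.
have ea : a = (a - U_(i) + U_(i))%MM by rewrite submK // lep1mP.
exists i, (a - U_(i))%MM; split=> //.
by move: da; rewrite {1}ea mdegD mdeg1 addn1 => -[].
Qed.

Lemma mdeg2_split n (a : 'X_{1..n}) : mdeg a = 2%N ->
  exists i j, a = (U_(i) + U_(j))%MM.
Proof.
move=> /mdegS_split[j [b [-> /mdegS_split[i [z [-> /eqP]]]]]].
by rewrite mdeg_eq0 => /eqP->; exists i, j; rewrite mpoly.add0m.
Qed.

Lemma Mconvex_Delta n d : Mconvex d [set` Delta n.+1 d].
Proof.
split=> //.
  by exists (U_(ord0) *+ d)%MM; rewrite /= in_Delta mdegMn mdeg1 mul1n.
move=> a b /=; rewrite !in_Delta => /eqP da /eqP db i ltba.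
have /existsP[j ltab] : [exists j, (a j < b j)%N].
  apply: contraLR ltba; rewrite negb_exists -leqNgt => /forallP le.
  have {}le k : (b k <= a k)%N by rewrite leqNgt.
  have := eq_leq (etrans da (esym db)); rewrite !mdegE (bigD1 i) //=.
  rewrite [leqRHS](bigD1 i) //= leqNgt => lt; rewrite leqNgt.
  apply: contra lt => lt; rewrite -addSn leq_add //.
  exact: leq_sum.
exists j; split=> //.
- rewrite in_Delta mdegD mdeg1 -[X in (_ + X)%N](mdeg1 i) -mdegD submK ?da //.
  by rewrite lep1mP -lt0n (leq_ltn_trans _ ltba).
- rewrite in_Delta mdegD mdeg1 -[X in (_ + X)%N](mdeg1 j) -mdegD submK ?db //.
  by rewrite lep1mP -lt0n (leq_ltn_trans _ ltab).
Qed.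

Lemma local_support_Delta n d (b : 'X_{1..n}) : (mdeg b + 2)%N = d ->
  local_support (Delta n d) b = Delta n 2.
Proof.
move=> db; apply/fsetP => g; rewrite in_Delta; apply/imfsetP/eqP => /=.
  by case=> p _ ->; rewrite mdegD !mdeg1.
move=> dg; have [i [j ->]] := mdeg2_split dg.
have bij : (b + (U_(i) + U_(j)))%MM \in Delta n d.
  by rewrite in_Delta !mdegD !mdeg1 -db.
by exists (i, j).
Qed.

(** * Polynomials with prescribed normalized coefficients *)

Section Polynomial.
Context {R : realType} {n : nat}.
Variables (S : {fset 'X_{1..n}}) (c : 'X_{1..n} -> R).

Definition normalized_poly : {mpoly R[n]} :=
  \sum_(a <- S) (c a / (\prod_(i < n) (a i)`!)%N%:R) *: 'X_[a].

Lemma ncoef_normalized_poly a : ncoef normalized_poly a = if a \in S then c a else 0.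
Proof.
rewrite /ncoef /normalized_poly (raddf_sum (mcoeff a)) /=. 
under [X in _ * X]eq_bigr do rewrite mcoeffZ mcoeffX.
have fact0 : (\prod_(i < n) (a i)`!)%N%:R != 0 :> R.
  by rewrite pnatr_eq0 -lt0n prodn_gt0 // => i; rewrite fact_gt0.
case: ifP => aS.
  rewrite (bigD1_seq a) ?fset_uniq //= eqxx.
  rewrite [X in _ * (_ + X)]big1 => [|b /negPf->].
    by rewrite addr0 mulr1 mulrC divfK.
  by rewrite mulr0.
rewrite [X in _ * X]big1_seq ?mulr0 // => b /= bS.
case: eqP => [ba|_]; last by rewrite mulr0.
by rewrite -ba bS in aS.
Qed.

Lemma normalized_poly_homog d : {subset S <= Delta n d} ->
  normalized_poly \is d.-homog.
Proof.
move=> Sd; rewrite /normalized_poly big_seq; apply: rpred_sum => a aS.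
by apply: rpredZ; rewrite dhomogX /= -in_Delta Sd.
Qed.

End Polynomial.

Section LineAndCut.
Context {R : realType} {n : nat}.
Implicit Types (l : 'I_n -> R) (P : pred 'I_n) (g : 'X_{1..n}).

(** On degree 2 exponents the parity term is the cut function of [P]: it is 1 at [e_i + e_j] exactly
    when [P] separates [i] from [j], and 0 at [2 e_i]. *)
Definition line_cut l P g : R :=
  \sum_i l i * (g i)%:R + (odd (\sum_(i | P i) g i))%:R.

Lemma line_cutU2 l P i j :
  line_cut l P (U_(i) + U_(j))%MM = l i + l j + (P i (+) P j)%:R.
Proof.
rewrite /line_cut; congr (_ + _).
  under eq_bigr do rewrite mnmDE !mnm1E natrD mulrDr.
  rewrite big_split /= (bigD1 i) //= [X in _ + X](bigD1 j) //= !eqxx !mulr1.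
  rewrite !big1 ?addr0 // => k /negPf; rewrite eq_sym => ->; exact: mulr0.
congr (_%:R); congr nat_of_bool.
under eq_bigr do rewrite mnmDE !mnm1E.
have sumE k : (\sum_(m | P m) (k == m) = P k)%N.
  case: (boolP (P k)) => Pk.
    rewrite (bigD1 k) //= eqxx big1 // => m /andP[_ /negPf].
    by rewrite eq_sym => ->.
  by rewrite big1 // => m Pm; case: eqP => // km; rewrite km Pm in Pk.
by rewrite big_split /= !sumE oddD !oddb.
Qed.

End LineAndCut.

(** Entries are [x i * x j], times [K] across the cut. So the matrix is [K] times a rank one square
    minus [K - 1] times the squares of the restrictions of [x] to the two sides, with [K >= 1]. *)
Lemma line_cut_at_most_one (R : realType) n (l : 'I_n -> R) (P : pred 'I_n) t :
  0 <= t ->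
  at_most_one_pos_eigenvalue
    (\matrix_(i, j) expR (t * line_cut l P (U_(i) + U_(j))%MM)).
Proof.
move=> t0; pose K := expR t; pose x i := expR (t * l i).
have K1 : 1 <= K by rewrite -[1](expR0 R) ler_expR.
pose L : 'rV[R]_n := \row_i (Num.sqrt K * x i).
pose B : 'M[R]_(2, n) :=
  \matrix_(k, i) (Num.sqrt (K - 1) * x i * ((k == 0) == P i)%:R).
suff -> : \matrix_(i, j) expR (t * line_cut l P (U_(i) + U_(j))%MM) =
    L^T *m L - B^T *m B by exact: at_most_one_pos_rank1B.
have sK : Num.sqrt K ^+ 2 = K by rewrite sqr_sqrtr // expR_ge0.
have sK1 : Num.sqrt (K - 1) ^+ 2 = K - 1 by rewrite sqr_sqrtr // subr_ge0.
apply/matrixP => i j; rewrite !mxE line_cutU2 !mulrDr !expRD -/(x i) -/(x j).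
rewrite big_ord1 big_ord_recl big_ord1 !mxE /=.
have -> : expR (t * (P i (+) P j)%:R) = if P i (+) P j then K else 1.
  by case: (_ (+) _); rewrite ?mulr1 // mulr0 expR0.
move: (Num.sqrt K) (Num.sqrt (K - 1)) sK sK1 => k k1 sK sK1.
case: (P i); case: (P j) => /=; ring: sK sK1.
Qed.

Lemma line_cut_lorentzian (R : realType) n (l : 'I_n.+1 -> R) P t : 0 <= t ->
  lorentzian_pos 2 (Delta n.+1 2)
    (normalized_poly (Delta n.+1 2) (fun g => expR (t * line_cut l P g))).
Proof.
move=> t0; set f := normalized_poly _ _.
have fE a : ncoef f a = if a \in Delta n.+1 2 then expR (t * line_cut l P a) else 0.
  exact: ncoef_normalized_poly.
have inD i j : (U_(i) + U_(j))%MM \in Delta n.+1 2.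
  by rewrite in_Delta mdegD !mdeg1.
split; last first.
  move=> a; rewrite fE; case: ifP => _; first by rewrite expR_gt0.
  by rewrite ltxx.
split.
- apply: contra_neq (lt0r_neq0 (expR_gt0 (t * line_cut l P (U_(ord0) + U_(ord0))%MM))).
  by move=> f0; have := fE (U_(ord0) + U_(ord0))%MM; rewrite inD f0 /ncoef mcoeff0 mulr0.
- exact: normalized_poly_homog.
- by move=> a; rewrite fE; case: ifP => // _; exact: expR_ge0.
- rewrite (_ : [set a | _] = [set` Delta n.+1 2]); first exact: Mconvex_Delta.
  apply/seteqP; split=> a /=; rewrite fE.
    by case: ifP => //; rewrite eqxx.
  by move=> ->; rewrite gt_eqF ?expR_gt0.
move=> b /eqP; rewrite -[2%N in X in _ == X]add0n eqn_add2r mdeg_eq0 => /eqP->.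
rewrite (_ : hessian f 0%MM = \matrix_(i, j) expR (t * line_cut l P (U_(i) + U_(j))%MM)).
  exact: line_cut_at_most_one.
by apply/matrixP => i j; rewrite !mxE mpoly.add0m fE inD.
Qed.

(** Along the exponentials of [t * line_cut l P] the ratio equals [expR (t * s)], bounded over all
    [t >= 0] only if [s <= 0]. Keeping [T] a variable lets the equation [T = Delta n.+1 2] be used
    although the type of [v] depends on [T]. *)
Lemma BR_line_cut (R : realType) n (T : {fset 'X_{1..n.+1}}) (v : 'R[R]^T)
    (l : 'I_n.+1 -> R) P :
  T = Delta n.+1 2 -> BR 2 T v -> \sum_(g : T) v g * line_cut l P (val g) <= 0.
Proof.
move=> TE; rewrite /BR /=; set E := [set _ | _ in _] => supE.
have [M EM] : exists M : R, forall f, lorentzian_pos 2 T f -> coef_ratio v f <= M.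
  case: (ereal_sup E) (@ereal_sup_ubound _ E) supE => [r|//|] h _.
    exists r => f fL; rewrite -lee_fin; apply: h.
    by exists f.
  exists 0 => f fL; rewrite -lee_fin.
  have : ((coef_ratio v f)%:E <= -oo)%E by apply: h; exists f.
  by rewrite leeNy_eq.
set s := \sum_(g : T) _; have {}EM t : 0 <= t -> expR (t * s) <= M.
  move=> t0; apply: le_trans (EM _ _); last first.
    by rewrite [X in lorentzian_pos _ X]TE; apply: (line_cut_lorentzian l P t0).
  rewrite /coef_ratio mulr_sumr expR_sum le_eqVlt; apply/orP; left; apply/eqP.
  apply: eq_bigr => g _; rewrite ncoef_normalized_poly -TE fsvalP.
  by rewrite -expRM; congr expR; ring.
rewrite leNgt; apply/negP => s0.
have M1 : 1 <= M by have := EM 0 (lexx 0); rewrite mul0r expR0.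
(* At [t = M / s] the bound would read [1 + M <= expR M <= M]. *)
have Ms0 : 0 <= M / s by rewrite divr_ge0 // ?ltW // (lt_le_trans ltr01).
have := le_trans (expR_ge1Dx (M / s * s)) (EM _ Ms0).
by rewrite divfK ?gt_eqF //; lra.
Qed.

(** * The separating weight *)

(* Found by linear programming, invariant under the exchanges 1 <-> 3 and
   2 <-> 4. *)
Definition sep_weight4 (a b c d : nat) : nat :=
  match (b + d)%N with
  | 0 => 2 * (0 < minn a c)
  | 1 => 1 + 2 * minn a c
  | 2 => 2 + 2 * (minn b d * minn a c)
  | 3 => 1 + 2 * minn b d
  | _ => 2 * minn b d
  end%N.

(* For [b = e_i + e_j], twice [sep_weight (b + -)] is a linear function
   plus twice the cuts along [sep_cut1 i j] and [sep_cut2 i j]; indices are counted from 0. *)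
Definition opp4 (i : nat) : nat := ((i + 2) %% 4)%N.

Definition sep_cut1 (i j : nat) : pred nat :=
  if i == j then if odd i then pred0 else pred1 (opp4 i)
  else if odd i (+) odd j then pred2 i (opp4 j)
  else if odd i then pred2 0%N 1%N else pred1 1%N.

Definition sep_cut2 (i j : nat) : pred nat :=
  if (i == j) || (odd i (+) odd j) then pred0
  else if odd i then pred2 0%N 3%N else pred1 3%N.

Definition sep_weight (a : 'X_{1..4}) : nat := sep_weight4 (a 0) (a 1) (a 2) (a 3).

Definition sep_weightU (i j k l : nat) : nat :=
  let cnt m := ((i == m) + (j == m) + (k == m) + (l == m))%N in
  sep_weight4 (cnt 0%N) (cnt 1%N) (cnt 2%N) (cnt 3%N).

(** A finite check over all index quadruples, doubled to stay in the integers. Cuts vanish at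
    [2 e_k], so the linear part is determined by the diagonal values. *)
Lemma sep_weightU_cut :
  all (fun i => all (fun j => all (fun k => all (fun l =>
    2 * sep_weightU i j k l == sep_weightU i j k k + sep_weightU i j l l
      + 2 * (sep_cut1 i j k (+) sep_cut1 i j l)
      + 2 * (sep_cut2 i j k (+) sep_cut2 i j l))%N
    (iota 0 4)) (iota 0 4)) (iota 0 4)) (iota 0 4).
Proof. by vm_compute. Qed.

Lemma sep_weightE (i j k l : 'I_4) :
  sep_weight (U_(i) + U_(j) + U_(k) + U_(l))%MM = sep_weightU i j k l.
Proof. rewrite /sep_weight !mnmDE !mnm1E /sep_weightU -!val_eqE. reflexivity. Qed.

Lemma sep_weight_line_cut (R : realType) (b : 'X_{1..4}) : mdeg b = 2%N ->
  exists l P Q, forall g, mdeg g = 2%N ->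
  (sep_weight (b + g))%:R = line_cut l P g + line_cut (fun=> 0) Q g :> R.
Proof.
move=> /mdeg2_split[i [j ->]].
exists (fun k => (sep_weightU i j k k)%:R / 2), (fun k : 'I_4 => sep_cut1 i j k),
  (fun k : 'I_4 => sep_cut2 i j k).
move=> _ /mdeg2_split[k [l ->]].
have i4 (m : 'I_4) : nat_of_ord m \in iota 0 4 by rewrite mem_iota add0n ltn_ord.
have := sep_weightU_cut => /allP/(_ _ (i4 i))/allP/(_ _ (i4 j)).
move=> /allP/(_ _ (i4 k))/allP/(_ _ (i4 l))/eqP/(congr1 (fun n => n%:R : R)).
cbv beta; rewrite !natrD !line_cutU2 mpoly.addmA sep_weightE.
lra.
Qed.

Definition sep_pairing (R : realType) (w : 'R[R]^(Delta 4 4)) : R :=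
  \sum_(a : Delta 4 4) w a * (sep_weight (val a))%:R.

(** The weights are 2, 2, 4 on the numerator and 2, 2, 2 on the denominator. *)
Lemma sep_pairing_w4 (R : realType) : sep_pairing (w4 R) = 2.
Proof.
rewrite /sep_pairing; under eq_bigr do rewrite w4E.
rewrite (big_fset_support _ (g := fun a => w4_fun R a * (sep_weight a)%:R)
  uniq_w4_support w4_support_sub); last first.
  by move=> a /(w4_fun0 R) ->; rewrite mul0r.
rewrite big_cat /= (eq_big_seq (fun a => (sep_weight a)%:R)) =>
  [|a /w4_fun_num->]; last first.
  by rewrite mul1r.
rewrite [X in _ + X](eq_big_seq (fun a => - (sep_weight a)%:R)) =>
  [|a /w4_fun_den->]; last first.
  by rewrite mulN1r.
rewrite !big_cons !big_nil /sep_weight !multinomE !(tnth_nth 0%N) /sep_weight4 /minn /=.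
ring.
Qed.

Lemma sep_pairing_local_lift (R : realType) (b : 'X_{1..4})
    (v : 'R[R]^(local_support (Delta 4 4) b)) :
  (mdeg b + 2)%N = 4%N -> BR 2 (local_support (Delta 4 4) b) v ->
  sep_pairing (local_lift v) <= 0.
Proof.
move=> db vBR; have TE := local_support_Delta db.
have dT (g : local_support (Delta 4 4) b) : mdeg (val g) = 2%N.
  by apply/eqP; rewrite -in_Delta -TE fsvalP.
have {}db2 : mdeg b = 2%N by apply/eqP; rewrite -(eqn_add2r 2) db.
have [l [P [Q pE]]] := sep_weight_line_cut R db2.
have -> : sep_pairing (local_lift v) =
    \sum_(g : local_support (Delta 4 4) b) v g * (sep_weight (b + val g))%:R.
  rewrite /sep_pairing; under eq_bigr do rewrite ffunE mulr_suml.
  rewrite exchange_big; apply: eq_bigr => g _ /=.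
  have bg : (b + val g)%MM \in Delta 4 4 by rewrite in_Delta mdegD dT db2.
  rewrite (bigD1 [` bg]%fset) //= eqxx mulr1 big1 ?addr0 // => a.
  by rewrite -val_eqE /= => /negPf->; rewrite mulr0 mul0r.
under eq_bigr do rewrite pE ?dT // mulrDr.
rewrite big_split /=.
have := BR_line_cut l P TE vBR; have := BR_line_cut (fun=> 0) Q TE vBR.
lra.
Qed.

Theorem theorem4p2 (R : realType) :
  (forall f : {mpoly R[4]}, lorentzian_pos 4 (Delta 4 4) f -> R4 f <= 64%:R) /\
  (BR 4 (Delta 4 4) `\`
     Cone (quadratic_local_generators 4 (Delta 4 4))) (w4 R).
Proof.
split; first exact: R4_le64.
split; first exact: w4_BR.
move=> [k [l [g [l0 gG w4E]]]].
(* The pairing is linear and nonpositive on generators, hence on the cone, but it equals 2 at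
   [w4]. *)
have : sep_pairing (w4 R) <= 0.
  rewrite w4E /sep_pairing.
  under eq_bigr do rewrite sum_ffunE mulr_suml.
  rewrite exchange_big; apply: sumr_le0 => i _ /=.
  under eq_bigr do rewrite ffunE -mulrA.
  rewrite -mulr_sumr mulr_ge0_le0 //.
  by have [b [db _ [v vBR ->]]] := gG i; exact: sep_pairing_local_lift.
by rewrite sep_pairing_w4; lra.
Qed.
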